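(* Consider repositories with $n$ packages in which all dependencies are known ($U=\emptyset$), no conflicts exist ($C=\emptyset$), and there are at most $r$ root defects (there may be as many as $n$ defects overall). The adaptive algorithm FindDefects$(P,K,r)$ described in the context (a variant of Generalized Binary Splitting guided by a topological sort) finds the root defects, and thus solves Full Learning, using at most $B+r-1$ queries, where $$B=\left\lceil \log_2\left(\sum_{i=0}^{r}\binom{n}{i}\right)\right\rceil .$$
   Context: A repository consists of a finite set $P$ of $n$ packages, a set $K\subseteq P\times P$ of known dependencies, a set $U\subseteq P\times P$ of unknown dependencies, a set $C$ of unknown conflicts (unordered pairs of distinct packages), and a set $D\subseteq P$ of defects. A pair $(q,p)\in K\cup U$ means that $q$ depends on $p$: any installation including $q$ but not $p$ fails. The digraph $(P,K)$ is acyclic. An installation is a subset $I\subseteq P$; it is successful iff it contains no defect, contains $p$ whenever it contains $q$ with $(q,p)\in K\cup U$, and contains no two packages $p,q$ with $\{p,q\}\in C$. Defects are the packages that cannot be part of any successful installation; thus a package that depends on a defect is itself a defect, i.e. $((P\setminus D)\times D)\cap(K\cup U)=\emptyset$. A root defect is a defect such that none of the packages it depends on is a defect. A query (test) is an installation $I\subseteq P$; an oracle answers whether it succeeds or fails. An adaptive algorithm asks one query at a time and may choose each query depending on previous answers. The cost is the number of queries. Full Learning: given $(P,K)$ and the bounds, return the mixed graph whose vertices are the strongly connected components of the packages with the defective packages marked, together with all conflicts and all dependencies. In the present setting this amounts to determining the defects. Algorithm FindDefects$(P,K,r)$. Maintain $S$ (identified non-defective packages), $R$ (identified root defects), $\mathfrak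 r$ (bound on the number of unidentified root defects) and $X$ (untested packages). Initially $S=R=\emptyset$, $\mathfrak r=r$, $X=P$. Let $L$ be a topological order of $(P,K)$ in which every package has a larger index than all packages it depends on. (1) While $|X|>2\mathfrak r-2$ (and $\mathfrak r>0$): set $l=|X|-\mathfrak r+1$ and $\alpha=\lfloor\log_2(l/\mathfrak r)\rfloor$; let $T$ be the $2^{\alpha}$ elements of $X$ with smallest $L$-indices; test $T\cup S$. If the test fails, call FindSingleDefect$(T)$, which returns a package $p$; add $p$ to $R$, remove from $X$ the package $p$ and all packages that depend on it, directly or through a chain of dependencies in $K$, and decrease $\mathfrak r$ by 1. If the test succeeds, replace $S$ by $S\cup T$. In either case then replace $X$ by $X\setminus S$. (2) Once the loop ends (if $\mathfrak r>0$), go through the packages $p\in X$ in increasing $L$-order and test $\{p\}\cup S$. If it fails, add $p$ to $R$ and remove from $X$ the package $p$ and all packages that depend on it, directly or through a chain of dependencies in $K$; otherwise add $p$ to $S$. (3) Return $R$. FindSingleDefect$(T)$: set $A=T$. While $|A|>1$: let $B'$ be the $|A|/2$ elements of $A$ with smallest $L$-indices and test $B'\cup S$; if it fails, replace $A$ by $B'$; otherwise replace $S$ by $S\cup B'$ (this changes the global set $S$) and $A$ by $A\setminus B'$. Return the single element of $A$. *)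

(* Defs.v *)
From mathcomp Require Import all_boot.

Set Implicit Arguments.
Unset Strict Implicit.
Unset Printing Implicit Defensive.

Section Repository.
Variable P : finType.
Implicit Types (E K : {set P * P}) (I D R : {set P}) (p q : P).

(* Dependencies are oriented as [(q, p)]: q depends on p. *)
Record repository := Repository {
  known : {set P * P};
  unknown : {set P * P};
  conflicts : {set {set P}};
  defects : {set P}
}.

Definition arc E : rel P := [rel q p | (q, p) \in E].

Definition acyclic E : Prop := forall c : seq P, cycle (arc E) c -> c = [::].

Definition dependencies (A : repository) : {set P * P} :=
  known A :|: unknown A.

Definition successful (A : repository) I : bool :=
  [&& [disjoint I & defects A],
      [forall q, forall p,
         (q \in I) && ((q, p) \in dependencies A) ==> (p \in I)] &
      [forall p in I, forall q in I, [set p; q] \notin conflicts A]].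

Definition valid_repository (A : repository) : Prop :=
  [/\ acyclic (known A),
      forall c, c \in conflicts A -> #|c| = 2 &
      forall p, p \in defects A <->
                (forall I, successful A I -> p \notin I)].

Definition root_defects (A : repository) : {set P} :=
  [set p in defects A |
     [forall q, ((p, q) \in dependencies A) ==> (q \notin defects A)]].

Definition mutually_reachable E : rel P :=
  [rel p q | connect (arc E) p q && connect (arc E) q p].

Definition sccs E : {set {set P}} :=
  equivalence_partition (mutually_reachable E) [set: P].

Record mixed_graph := MixedGraph {
  mg_vertices : {set {set P}};
  mg_marked : {set P};
  mg_arcs : {set P * P};
  mg_edges : {set {set P}}
}.

Definition full_learning (A : repository) : mixed_graph :=
  MixedGraph (sccs (dependencies A)) (defects A)
             (dependencies A) (conflicts A).

(* Packages that depend on p through a chain in K of length >= 0, so that p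
   itself is included. *)
Definition dependents K p : {set P} := [set q | connect (arc K) q p].

(* The answer to Full Learning assembled from K and a set R of root defects,
   for repositories without unknown dependencies and conflicts. *)
Definition learned_graph K R : mixed_graph :=
  MixedGraph (sccs K) (\bigcup_(p in R) dependents K p) K set0.

Definition topological_order K (L : seq P) : Prop :=
  [/\ uniq L, forall p, p \in L &
      forall q p, (q, p) \in K -> index p L < index q L].

(* Adaptive algorithms are decision trees, whose only access to the repository
   is through the answers to their queries ([true] means success). [Stuck]
   marks a loop that exceeds its iteration bound or an ill-formed return; it
   makes [run] fail, so a result [Some _] certifies genuine termination. *)
Inductive strategy (T : Type) : Type :=
| Return of T
| Query of {set P} & (bool -> strategy T)
| Stuck.

Fixpoint bind (T U : Type) (s : strategy T) (f : T -> strategy U) : strategy U :=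
  match s with
  | Return x => f x
  | Query J k => Query J (fun b => bind (k b) f)
  | Stuck => Stuck U
  end.

(* The result together with the number of queries. *)
Fixpoint run (T : Type) (oracle : {set P} -> bool) (s : strategy T) :
    option (T * nat) :=
  match s with
  | Return x => Some (x, 0)
  | Query J k =>
      if run oracle (k (oracle J)) is Some (x, c) then Some (x, c.+1) else None
  | Stuck => None
  end.

Fixpoint while (T : Type) (fuel : nat) (cond : T -> bool)
    (body : T -> strategy T) (x : T) : strategy T :=
  if cond x then
    if fuel is m.+1 then bind (body x) (while m cond body) else Stuck T
  else Return x.

Section Algorithm.
Variables (K : {set P * P}) (L : seq P).

Definition in_order (X : {set P}) : seq P := [seq p <- L | p \in X].

(* The k elements of X with smallest L-indices. *)
Definition smallest (k : nat) (X : {set P}) : {set P} :=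
  [set p in take k (in_order X)].

(* G is the set of identified non-defective packages (S being taken by the
   successor of nat), threaded through since the procedure enlarges it. *)
Definition find_single_defect (G T : {set P}) : strategy ({set P} * P) :=
  bind
    (@while ({set P} * {set P}) #|T|
       (fun '(G, A) => 1 < #|A|)
       (fun '(G, A) =>
          let B := smallest (#|A| %/ 2) A in
          Query (B :|: G) (fun success =>
            Return (if success then (G :|: B, A :\: B) else (G, B))))
       (G, T))
    (fun '(G, A) =>
       if [pick p in A] is Some p then Return (G, p) else Stuck _).

Record state := State {
  st_G : {set P};
  st_R : {set P};
  st_r : nat;
  st_X : {set P}
}.

Definition main_cond (s : state) : bool :=
  (0 < st_r s) && (2 * st_r s - 2 < #|st_X s|).

(* [trunc_log 2 (l %/ r)] is the floor of the binary logarithm of the rational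
   l / r: a power of two is at most l / r iff it is at most its integer part.
   Under [main_cond], l >= r and no subtraction is truncated. *)
Definition main_body (s : state) : strategy state :=
  let: State G R r X := s in
  let l := #|X| - r + 1 in
  let alpha := trunc_log 2 (l %/ r) in
  let T := smallest (2 ^ alpha) X in
  Query (T :|: G) (fun success =>
    if success then
      let G' := G :|: T in Return (State G' R r (X :\: G'))
    else
      bind (find_single_defect G T) (fun '(G', p) =>
        Return (State G' (p |: R) (r - 1) ((X :\: dependents K p) :\: G')))).

(* ps lists the packages still to be visited; those removed from X in the
   meantime are skipped. *)
Fixpoint test_individually (ps : seq P) (G R X : {set P}) : strategy {set P} :=
  if ps is p :: ps' then
    if p \in X then
      Query (p |: G) (fun success =>
        if success then test_individually ps' (p |: G) R X
        else test_individually ps' G (p |: R) (X :\: dependents K p))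
    else test_individually ps' G R X
  else Return R.

Definition find_defects (r : nat) : strategy {set P} :=
  bind (while #|P| main_cond main_body (State set0 set0 r [set: P]))
    (fun '(State G R r X) =>
       if 0 < r then test_individually (in_order X) G R X else Return R).

End Algorithm.
End Repository.

(* Main.v *)
Require Import Defs.
From mathcomp Require Import all_boot.
From mathcomp Require Import zify.

(* Correctness: the tested sets T are prefixes of a topological order, so T :|: G
   is closed under dependencies and a test fails iff T contains a defect; the
   single package left by the binary search has all its dependencies in G, hence
   is a root defect.
   Query bound: with n untested packages, at most d > 0 root defects among them and
   l = n + 1 - d, the number c of remaining queries satisfies
   c < (a + 1) d + floor (l / 2 ^ a) for every a, the exponent chosen by the
   algorithm being the optimal a.  A successful test lowers the floor by one, and a
   failed one costs a + 1 queries while l does not grow and d decreases.  Writing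
   floor (l / 2 ^ a) = d + p with p < d, the bound becomes B + d - 1 because
   C(n, d) >= l ^ d / d! >= 2 ^ (a d) (d + p) ^ d / d! >= 2 ^ (a d + d + p - 1),
   by (d + p) ^ d >= 2 ^ p d ^ d and d ^ d >= 2 ^ (d - 1) d!. *)

Set Implicit Arguments.
Unset Strict Implicit.
Unset Printing Implicit Defensive.

(** * Lower bounds for binomial coefficients by powers of two *)

Lemma exp_leq_ffact n k : (n + 1 - k) ^ k <= n ^_ k.
Proof.
(* The exponent is freed from [k] so that the base stays fixed in the induction; each factor [n - j]
   with [j < k] is at least [n + 1 - k]. *)
suff H j : j <= k -> (n + 1 - k) ^ j <= n ^_ j by exact: H.
elim: j => [|j IHj] ltjk; first by rewrite ffactn0.
rewrite ffactnSr expnSr leq_mul ?IHj ?(ltnW ltjk) //; lia.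
Qed.

(** Factor by factor, [(p - i) d <= (d - i) p] because [p <= d]. *)
Lemma ffact_exp_cross p d i : p <= d -> p ^_ i * d ^ i <= d ^_ i * p ^ i.
Proof.
move=> le_pd; elim: i => [|i IHi]; first by rewrite !ffactn0.
rewrite !ffactnSr !expnSr mulnACA [leqRHS]mulnACA leq_mul //; nia.
Qed.

(* Termwise comparison of the expansions of [(d + p) ^ d] and of
   [d ^ d * (1 + 1) ^ p]; over the reals it says [2 ^ x <= 1 + x] for
   [x = p / d] in [[0, 1]]. *)
Lemma leq_exp2_expD p d : p <= d -> d ^ d * 2 ^ p <= (d + p) ^ d.
Proof.
move=> le_pd; rewrite -[2]/(1 + 1) !expnDn big_distrr /=.
(* Of the [d + 1] terms of [(d + p) ^ d] only the first [p + 1] are kept. *)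
rewrite -(subnKC le_pd) -addSn big_split_ord /= subnKC //.
apply: leq_trans (leq_addr _ _); apply: leq_sum => i _.
have le_id : i <= d by apply: leq_trans le_pd; rewrite -ltnS.
rewrite !exp1n !muln1 -[X in _ ^ X * _](subnK le_id) expnD -mulnA.
rewrite [leqRHS]mulnCA leq_mul2l; apply/orP; right.
rewrite -(leq_pmul2r (fact_gt0 i)) -mulnA bin_ffact mulnAC bin_ffact mulnC.
exact: ffact_exp_cross.
Qed.

Lemma exp2_fact_leq d : 2 ^ d.-1 * d`! <= d ^ d.
Proof.
elim: d => [//|[//|d] IHd].
(* The case [p = 1] is the Bernoulli inequality that doubles the bound. *)
have := @leq_exp2_expD 1 d.+1 isT; rewrite addn1 expn1 => step.
have {}IHd : 2 ^ d * d.+1`! <= d.+1 ^ d.+1 by exact: IHd.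
by rewrite factS [leqRHS]expnS [_.-1]/= expnS; nia.
Qed.

Lemma exp2_leq_bin n d p a :
  0 < d -> p <= d -> 2 ^ a * (d + p) <= n + 1 - d ->
  2 ^ (a.+1 * d + p).-1 <= 'C(n, d).
Proof.
move=> d_gt0 le_pd le_l; rewrite -(leq_pmul2r (fact_gt0 d)) bin_ffact.
apply: leq_trans (exp_leq_ffact n d).
apply: leq_trans (_ : (2 ^ a * (d + p)) ^ d <= _); last by rewrite leq_exp2r.
rewrite expnMn -expnM.
have -> : (a.+1 * d + p).-1 = a * d + (d.-1 + p) by lia.
rewrite expnD -mulnA leq_mul2l; apply/orP; right.
apply: leq_trans (leq_exp2_expD le_pd).
by rewrite expnD mulnAC leq_mul2r exp2_fact_leq orbT.
Qed.

Lemma ltn_up_log2 k m : 2 ^ k.-1 < m -> k <= up_log 2 m.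
Proof.
move=> lt_m; rewrite leqNgt; apply/negP => lt_k.
have := up_logP m (isT : 1 < 2).
have : 2 ^ up_log 2 m <= 2 ^ k.-1 by rewrite leq_exp2l //; lia.
by lia.
Qed.

(** The term [i = 0] makes the inequality strict, which is what [ltn_up_log2] needs to gain a unit
    in the logarithm. *)
Lemma bin_lt_sum n d : 0 < d -> 'C(n, d) < \sum_(0 <= i < d.+1) 'C(n, i).
Proof.
case: d => // d _; rewrite big_nat_recr //= big_nat_recl //= bin0.
by rewrite -addnA add1n ltnS leq_addl.
Qed.

(** * The exponent chosen by the algorithm and the cost recurrence *)

Definition gbs_exponent d n := trunc_log 2 ((n - d + 1) %/ d).

Lemma exp2_gbs_exponent_leq d n :
  0 < d -> 2 * d - 2 < n -> 2 ^ gbs_exponent d n <= n.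
Proof.
move=> d_gt0 lt_n; apply: leq_trans (trunc_logP _ _) _ => //.
  by rewrite divn_gt0 //; lia.
by apply: leq_trans (leq_div _ _) _; lia.
Qed.

(* Over [l = n + 1 - d], the bound is [(a + 1) d + floor (l / 2 ^ a)]; as a
   function of [a] it is least when [floor (l / 2 ^ a)] falls in [[d, 2 d)]. *)
Lemma gbs_exponent_min d n a (b := gbs_exponent d n) :
  0 < d -> 2 * d - 2 < n ->
  [/\ d <= (n + 1 - d) %/ 2 ^ b, (n + 1 - d) %/ 2 ^ b < 2 * d &
      b.+1 * d + (n + 1 - d) %/ 2 ^ b <= a.+1 * d + (n + 1 - d) %/ 2 ^ a].
Proof.
move=> d_gt0 lt_n; have El : n - d + 1 = n + 1 - d by lia.
rewrite {}/b /gbs_exponent {}El; set l := n + 1 - d; set b := trunc_log _ _.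
have le_dl : d <= l by rewrite /l; lia.
have q_gt0 : 0 < l %/ d by rewrite divn_gt0.
have /andP[] := @trunc_log_bounds 2 _ isT q_gt0; rewrite -/b => lo hi.
have e_gt0 k : 0 < 2 ^ k by rewrite expn_gt0.
have lo' : d <= l %/ 2 ^ b by rewrite leq_divRL // mulnC -leq_divRL.
have hi' : l %/ 2 ^ b < 2 * d.
  by rewrite ltn_divLR // mulnAC -expnS -ltn_divLR.
split=> //; case: (ltngtP a b) => [lt_ab|lt_ba|-> //].
(* With [k = b - a], the quotient at [a] is at least [2 ^ k q >= q + k q], and [q >= d] pays for the
   [k d] saved. *)
- have := lo'; have -> : l %/ 2 ^ b = l %/ 2 ^ a %/ 2 ^ (b - a).
    by rewrite -divnMA -expnD subnKC // ltnW.
  have := leq_divM (l %/ 2 ^ a) (2 ^ (b - a)).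
  set q := _ %/ 2 ^ (b - a); have := ltn_expl (b - a) (isT : 1 < 2).
  set k := b - a; have -> : b = a + k by rewrite /k; lia.
  by move: (2 ^ k) => e; nia.
- have -> : l %/ 2 ^ a = l %/ 2 ^ b %/ 2 ^ (a - b).
    by rewrite -divnMA -expnD subnKC // ltnW.
  (* One step above [b], halving a quotient below [2 d] saves at most [d]; further up, the added
     [2 d] alone exceeds that quotient. *)
  case Ek : (a - b) => [|[|k]]; first by lia.
    by have -> : a = b.+1 by [lia]; rewrite expn1 !mulSn; lia.
  have -> : a.+1 = b.+1 + k.+2 by lia.
  apply: leq_trans (leq_addr _ _); rewrite mulnDl leq_add2l !mulSn.
  by move: (l %/ _) hi' => m; lia.
Qed.

(* The cost allowed to the splitting algorithm with [n] packages left, of which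
   at most [d] are root defects; it has to hold for all [a] because the exponent
   used by the algorithm changes along the way. *)
Definition gbs_bound d n c :=
  0 < d -> forall a, c < a.+1 * d + (n + 1 - d) %/ 2 ^ a.

(** At [a = 0] the bound is at least [n + 1]; for larger [a], [(a + 1) d] alone exceeds
    [2 d - 2]. *)
Lemma gbs_bound_linear d n c : c <= n -> n <= 2 * d - 2 -> gbs_bound d n c.
Proof.
move=> le_cn le_n d_gt0 [|a]; first by rewrite divn1; lia.
by nia.
Qed.

(** The hypothesis is used at the exponent [b] only; minimality of [b] carries the bound to every
    [a]. A failed test is treated likewise. *)
Lemma gbs_bound_success d n c (b := gbs_exponent d n) :
  2 * d - 2 < n -> gbs_bound d (n - 2 ^ b) c -> gbs_bound d n c.+1.
Proof.
move=> lt_n bnd d_gt0 a; have [lo hi] := gbs_exponent_min a d_gt0 lt_n.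
apply: leq_trans; have := bnd d_gt0 b; rewrite -/b in lo hi *.
have -> : n - 2 ^ b + 1 - d = n + 1 - d - 1 * 2 ^ b.
  have : 2 ^ b <= n + 1 - d.
    by rewrite -[leqLHS]mul1n -leq_divRL ?expn_gt0 //; lia.
  by lia.
by rewrite divnBMl; lia.
Qed.

(** For [d = 1] the guard in [gbs_bound] empties the hypothesis on [c], hence the separate
    condition: no query follows the last root defect. *)
Lemma gbs_bound_failure d n n' c (b := gbs_exponent d n) :
  2 * d - 2 < n -> n' < n -> gbs_bound (d - 1) n' c -> (d = 1 -> c = 0) ->
  gbs_bound d n (b + c).+1.
Proof.
move=> lt_n lt_n' bnd c0 d_gt0 a; have [lo hi] := gbs_exponent_min a d_gt0 lt_n.
apply: leq_trans; rewrite -/b in lo hi *.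
have [d1|d1] := eqVneq d 1; first by rewrite c0 // d1; move: lo; rewrite d1; lia.
have d1_gt0 : 0 < d - 1 by lia.
have := bnd d1_gt0 b.
have : (n' + 1 - (d - 1)) %/ 2 ^ b <= (n + 1 - d) %/ 2 ^ b by apply: leq_div2r; lia.
by nia.
Qed.

Lemma gbs_bound_up_log d n c :
  gbs_bound d n c -> 0 < d ->
  c <= up_log 2 (\sum_(0 <= i < d.+1) 'C(n, i)) + d - 1.
Proof.
move=> bnd d_gt0; have [lt_n|le_n] := ltnP (2 * d - 2) n.
  have [lo hi _] := gbs_exponent_min 0 d_gt0 lt_n.
  have := bnd d_gt0 (gbs_exponent d n).
  set b := gbs_exponent d n in lo hi *.
  set m := _ %/ _ in lo hi * => lt_c.
  have le_m : 2 ^ b * (d + (m - d)) <= n + 1 - d.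
    by rewrite subnKC // mulnC leq_divM.
  have le_p : m - d <= d by lia.
  have := ltn_up_log2 (leq_ltn_trans (exp2_leq_bin d_gt0 le_p le_m) (bin_lt_sum n d_gt0)).
  by lia.
have := bnd d_gt0 0; rewrite divn1 => lt_c.
have [lt_nd|le_dn] := ltnP n d; first by lia.
(* Now [d <= n <= 2 d - 2] and [c <= n], so it is enough that the sum is at least that of the
   ['C(d, i)], namely [2 ^ d]. *)
suff : d <= up_log 2 (\sum_(0 <= i < d.+1) 'C(n, i)) by lia.
apply: ltn_up_log2; apply: (@leq_trans (2 ^ d)); first by rewrite ltn_exp2l ?prednK.
rewrite -[2]/(1 + 1) expnDn big_mkord.
by apply: leq_sum => i _; rewrite !exp1n !muln1 leq_bin2l.
Qed.

(** * Running composed strategies *)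

Lemma run_bind (P : finType) T U (oracle : {set P} -> bool) (s : strategy P T)
    (f : T -> strategy P U) :
  run oracle (bind s f) =
  if run oracle s is Some (x, c) then
    if run oracle (f x) is Some (y, c') then Some (y, c + c') else None
  else None.
Proof.
elim: s => [x|J k IHk|] //=; first by case: run => [[y c]|].
by rewrite IHk; case: (run _ (k _)) => [[x c]|] //; case: run => [[y c']|].
Qed.

(** Stated through [run], as equality of the strategies themselves would require functional
    extensionality for their continuations. *)
Lemma run_bindA (P : finType) T U V (oracle : {set P} -> bool) (s : strategy P T)
    (f : T -> strategy P U) (g : U -> strategy P V) :
  run oracle (bind (bind s f) g) = run oracle (bind s (fun x => bind (f x) g)).
Proof. by elim: s => [x|J k IHk|] //=; rewrite IHk. Qed.

(** * Prefixes of a topological order *)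

Section Smallest.
Variables (P : finType) (K : {set P * P}) (L : seq P).
Hypothesis hL : topological_order K L.
Implicit Type X : {set P}.

Lemma pairwise_index (s : seq P) : uniq s ->
  pairwise [rel p q | index p s < index q s] s.
Proof.
case Es: s => [//|x0 t]; rewrite -Es => uniq_s; apply/(pairwiseP x0) => i j lti ltj lt_ij /=.
by rewrite !index_uniq.
Qed.

Lemma pairwise_in_order X :
  pairwise [rel p q | index p L < index q L] (in_order L X).
Proof. by have [uniqL _ _] := hL; apply/pairwise_filter/pairwise_index. Qed.

Lemma mem_in_order X p : (p \in in_order L X) = (p \in X).
Proof. by have [_ memL _] := hL; rewrite mem_filter memL andbT. Qed.

Lemma uniq_in_order X : uniq (in_order L X).
Proof. by have [uniqL _ _] := hL; rewrite filter_uniq. Qed.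

Lemma size_in_order X : size (in_order L X) = #|X|.
Proof.
by rewrite -(card_uniqP (uniq_in_order X)); apply: eq_card => p; rewrite mem_in_order.
Qed.

Lemma smallest_subset k X : smallest L k X \subset X.
Proof.
by apply/subsetP => p; rewrite inE => /mem_take; rewrite mem_in_order.
Qed.

Lemma card_smallest k X : k <= #|X| -> #|smallest L k X| = k.
Proof.
move=> le_k; rewrite cardsE (card_uniqP _) ?take_uniq ?uniq_in_order //.
by rewrite size_takel ?size_in_order.
Qed.

Lemma smallest_dependency k X q p :
  (q, p) \in K -> q \in smallest L k X -> p \in X -> p \in smallest L k X.
Proof.
have [_ _ topo] := hL => /topo lt_pq; rewrite !inE => qT.
rewrite -mem_in_order -{1}(cat_take_drop k (in_order L X)) mem_cat.
case/orP => // pT; have := pairwise_in_order X.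
rewrite -{1}(cat_take_drop k (in_order L X)) pairwise_cat.
by case/andP => /allrelP/(_ _ _ qT pT) /=; rewrite ltnNge ltnW.
Qed.

End Smallest.

(** * Tests, defects and root defects *)

Section Correctness.
Variables (P : finType) (A : repository P) (L : seq P).
Hypothesis hA : valid_repository A.
Hypothesis hU : unknown A = set0.
Hypothesis hC : conflicts A = set0.
Hypothesis hL : topological_order (known A) L.
Implicit Types (G R X T : {set P}) (p q x : P).

Local Notation K := (known A).
Local Notation D := (defects A).

Lemma dependenciesE : dependencies A = K.
Proof. by rewrite /dependencies hU setU0. Qed.

Definition closed_modulo G X :=
  forall q p, (q, p) \in K -> q \in X -> p \in X :|: G.

Definition safe G := closed_modulo set0 G /\ [disjoint G & D].

Lemma successful_safe T G :
  safe G -> closed_modulo G T -> successful A (T :|: G) = [disjoint T & D].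
Proof.
case=> clG disG clT; rewrite /successful hC dependenciesE.
have -> : [disjoint T :|: G & D] = [disjoint T & D].
  by rewrite !disjoints_subset subUset -[G \subset _]disjoints_subset disG andbT.
apply: andb_idr => _; apply/andP; split.
  apply/forallP => q; apply/forallP => p; apply/implyP => /andP[+ Kqp].
  by rewrite inE => /orP[/(clT _ _ Kqp)//|/(clG _ _ Kqp)]; rewrite !inE orbF orbC => ->.
by apply/forall_inP => p _; apply/forall_inP => q _; rewrite inE.
Qed.

Lemma dependent_defect q p : (q, p) \in K -> p \in D -> q \in D.
Proof.
have [_ _ defD] := hA => Kqp /defD pD; apply/defD => I sI; apply/negP => qI.
have /and3P[_ /forallP/(_ q)/forallP/(_ p)] := sI.
by rewrite dependenciesE Kqp qI (negPf (pD I sI)).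
Qed.

Lemma connect_defect q p : connect (Defs.arc K) q p -> p \in D -> q \in D.
Proof.
case/connectP => s; elim: s q => [|x s IHs] q /=; first by move=> _ ->.
by case/andP => Kqx pth defp /(IHs x pth defp); apply: dependent_defect.
Qed.

Lemma root_defectsP p :
  reflect (p \in D /\ forall q, (p, q) \in K -> q \notin D) (p \in root_defects A).
Proof.
rewrite inE dependenciesE; apply: (iffP andP) => -[pD].
  by move=> /forallP rootp; split=> // q Kpq; apply: (implyP (rootp q)).
by move=> rootp; split=> //; apply/forallP => q; apply/implyP/rootp.
Qed.

(** Descent along [L]: a defect that is not a root has a defective dependency of smaller index. *)
Lemma connect_root_defect q :
  q \in D -> exists2 p, p \in root_defects A & connect (Defs.arc K) q p.
Proof.
have [_ _ topo] := hL.
have [k] := ubnP (index q L); elim: k q => // k IHk q lt_k qD.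
have [rootq|] := boolP (q \in root_defects A); first by exists q.
rewrite inE qD dependenciesE /= negb_forall => /existsP[x].
rewrite negb_imply negbK => /andP[Kqx xD].
have [|p rootp xp] := IHk x _ xD; first by have := topo _ _ Kqx; lia.
by exists p => //; apply: connect_trans xp; apply: connect1.
Qed.

Definition all_dependents R := \bigcup_(p in R) dependents K p.

Lemma all_dependents_arc R q p :
  (q, p) \in K -> p \in all_dependents R -> q \in all_dependents R.
Proof.
move=> Kqp /bigcupP[x xR]; rewrite inE => px; apply/bigcupP; exists x => //.
by rewrite inE; apply: connect_trans px; apply: connect1.
Qed.

Lemma subset_all_dependents R : R \subset all_dependents R.
Proof. by apply/subsetP => p pR; apply/bigcupP; exists p; rewrite ?inE. Qed.

Lemma all_dependents_root_defects : all_dependents (root_defects A) = D.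
Proof.
apply/setP => q; apply/bigcupP/idP => [[p /root_defectsP[pD _]]|].
  by rewrite inE => /connect_defect; apply.
by case/connect_root_defect => p rootp qp; exists p => //; rewrite inE.
Qed.

(** A nonempty chain from [p] to a member of [R] would begin with a defective dependency of [p].
    Hence discarding dependents never loses another root defect. *)
Lemma root_defect_dependent R p :
  R \subset root_defects A -> p \in root_defects A -> p \in all_dependents R ->
  p \in R.
Proof.
move=> /subsetP rootR /root_defectsP[_ rootp] /bigcupP[x xR].
rewrite inE => /connectP[[_ defx|y s /= /andP[Kpy pth] defx]].
  by rewrite -[p]defx.
have /root_defectsP[xD _] := rootR x xR; case/negP: (rootp y Kpy).
by apply: connect_defect xD; apply/connectP; exists s.
Qed.

Lemma root_defects_covered R G :
  R \subset root_defects A -> safe G ->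
  {in root_defects A, forall p, p \in all_dependents R :|: G} ->
  R = root_defects A.
Proof.
move=> rootR [_ disG] cov; apply/eqP; rewrite eqEsubset rootR /=.
apply/subsetP => p rootp; have := cov p rootp; rewrite inE => /orP[|pG].
  exact: root_defect_dependent.
by have /root_defectsP[pD _] := rootp; rewrite (disjointFr disG pG) in pD.
Qed.

Lemma safeU G T :
  safe G -> closed_modulo G T -> [disjoint T & D] -> safe (G :|: T).
Proof.
move=> [clG disG] clT disT; split; last first.
  by rewrite disjoints_subset subUset -!disjoints_subset disG.
move=> q p Kqp; rewrite !inE => /orP[/(clG _ _ Kqp)|/(clT _ _ Kqp)].
  by rewrite !inE orbF => ->.
by rewrite !inE => /orP[] ->; rewrite ?orbT.
Qed.

Lemma closed_modulo_smallest k G X :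
  closed_modulo G X -> closed_modulo G (smallest L k X).
Proof.
move=> clX q p Kqp qT; rewrite inE.
have := clX q p Kqp (subsetP (smallest_subset hL k X) q qT); rewrite inE.
by case/orP => [/(smallest_dependency hL Kqp qT)->//|->]; rewrite orbT.
Qed.

Lemma closed_moduloD G T B :
  closed_modulo G T -> closed_modulo (G :|: B) (T :\: B).
Proof.
move=> clT q p Kqp; rewrite !inE => /andP[_ /(clT _ _ Kqp)].
by rewrite !inE => /orP[] ->; rewrite ?orbT //; case: (p \in B); rewrite ?orbT.
Qed.

(** * Binary search for one root defect *)

Definition single_cond (x : {set P} * {set P}) : bool := let: (_, B) := x in 1 < #|B|.

(** With [single_cond], a named form, up to conversion, of the anonymous loop functions of
    [find_single_defect], so that an induction can be stated. *)
Definition single_body (x : {set P} * {set P}) : strategy P ({set P} * {set P}) :=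
  let: (G, T) := x in
  let B := smallest L (#|T| %/ 2) T in
  Query (B :|: G) (fun success =>
    Return P (if success then (G :|: B, T :\: B) else (G, B))).

(** Both answers preserve the hypotheses: a successful half joins [G] and leaves the rest closed
    modulo it, a failing half is a prefix of [T]. Each round halves [T], so exactly [a] queries are
    spent. *)
Lemma run_single_loop m a G T :
  a <= m -> #|T| = 2 ^ a -> safe G -> closed_modulo G T -> ~~ [disjoint T & D] ->
  exists G' p,
    [/\ run (successful A) (while m single_cond single_body (G, T)) =
          Some ((G', [set p]), a),
        safe G', G \subset G', p \in T & p \in root_defects A].
Proof.
elim: a m G T => [|a IHa] m G T.
  move=> _ cardT sG clT meetsD; have /cards1P[p defT] : #|T| == 1 by rewrite cardT.
  have pD : p \in D by move: meetsD; rewrite defT disjoints1 negbK.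
  exists G, p; split=> //; first by rewrite defT; case: m => [|m] /=; rewrite cards1.
    by rewrite defT set11.
  apply/root_defectsP; split=> // q Kpq.
  have := clT p q Kpq; rewrite defT set11 => /(_ isT).
  have [clG disG] := sG; have [_ _ topo] := hL.
  rewrite !inE => /orP[/eqP defq|/(disjointFr disG)->//].
  by have := topo _ _ Kpq; rewrite defq ltnn.
case: m => // m le_am cardT sG clT meetsD.
have cond : 1 < #|T| by rewrite cardT expnS; have := expn_gt0 2 a; lia.
set B := smallest L (#|T| %/ 2) T.
have half : #|T| %/ 2 = 2 ^ a by rewrite cardT expnS mulKn.
have cardB : #|B| = 2 ^ a by rewrite /B half (card_smallest hL) // cardT leq_exp2l.
have subB : B \subset T by apply: smallest_subset hL _ _.
have clB : closed_modulo G B by exact: closed_modulo_smallest.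
have -> : run (successful A) (while m.+1 single_cond single_body (G, T)) =
  if run (successful A) (while m single_cond single_body
        (if [disjoint B & D] then (G :|: B, T :\: B) else (G, B)))
    is Some (x, c) then Some (x, c.+1) else None.
  by rewrite /= cond /= -/B (successful_safe sG clB).
have [disB|meetsB] := ifPn.
  have [||||G' [p [-> sG' sub pT rootp]]] := IHa m (G :|: B) (T :\: B) le_am.
  - by rewrite cardsD (setIidPr subB) cardB cardT expnS; lia.
  - exact: safeU.
  - exact: closed_moduloD.
  - apply: contra meetsD; rewrite !disjoints_subset => disTB.
    by rewrite -(setID T B) subUset disTB (setIidPr subB) -disjoints_subset disB.
  exists G', p; split=> //; first by apply: subset_trans sub; apply: subsetUl.
  by move: pT; rewrite inE => /andP[].
have [G' [p [-> sG' sub pT rootp]]] := IHa m G B le_am cardB sG clB meetsB.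
by exists G', p; split=> //; apply: (subsetP subB).
Qed.

Lemma run_find_single_defect a G T :
  #|T| = 2 ^ a -> safe G -> closed_modulo G T -> ~~ [disjoint T & D] ->
  exists G' p,
    [/\ run (successful A) (find_single_defect L G T) = Some ((G', p), a),
        safe G', G \subset G', p \in T & p \in root_defects A].
Proof.
move=> cardT sG clT meetsD.
have le_aT : a <= #|T| by rewrite cardT ltnW // ltn_expl.
have [G' [p [Erun sG' sub pT rootp]]] := run_single_loop le_aT cardT sG clT meetsD.
exists G', p; split=> //; rewrite /find_single_defect run_bind.
rewrite -[run _ (while _ _ _ _)]/(run _ (while _ single_cond single_body _)) Erun.
case: pickP => [q|/(_ p)]; last by rewrite set11.
by rewrite inE => /eqP-> /=; rewrite addn0.
Qed.

(** * Testing the remaining packages one by one *)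

Lemma all_dependentsU1 p R :
  all_dependents (p |: R) = dependents K p :|: all_dependents R.
Proof. by rewrite /all_dependents bigcup_setU big_set1. Qed.

(** When [p] is tested its dependencies lie in [G]: their smaller indices exclude them from the rest
    of [ps], and one in [all_dependents R] would put [p] there too. *)
Lemma run_test_individually ps G R X :
  pairwise [rel p q | index p L < index q L] ps -> uniq ps ->
  safe G -> R \subset root_defects A ->
  {in ps, forall p, (p \in X) = (p \notin all_dependents R)} ->
  (forall p, [|| p \in ps, p \in all_dependents R | p \in G]) ->
  exists2 c,
    run (successful A) (test_individually K ps G R X) = Some (root_defects A, c) &
    c <= size ps.
Proof.
elim: ps G R X => [|p ps IHps] G R X.
  move=> _ _ sG rootR _ cov; exists 0 => //=; congr (Some (_, _)).
  by apply: (root_defects_covered rootR sG) => x _; rewrite inE; apply: cov.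
rewrite pairwise_cons cons_uniq => /andP[/allP ltps pw] /andP[p_ps uniq_ps].
move=> sG rootR memX cov; have in_ps q : q \in ps -> q \in p :: ps.
  by rewrite inE orbC => ->.
have [_ _ topo] := hL; rewrite /=; have [pX|pX] := ifP; last first.
  have [||c -> le_c] := IHps G R X pw uniq_ps sG rootR.
  - by move=> q /in_ps; apply: memX.
  - move=> q; have := cov q; rewrite inE -orbA => /orP[/eqP->|//].
    by have := memX p (mem_head _ _); rewrite pX => /esym/negbFE->; rewrite orbT.
  by exists c => //; apply: leqW.
have p_dep : p \notin all_dependents R by rewrite -memX ?mem_head.
have clp : closed_modulo G [set p].
  move=> x q Kxq /set1P defx; rewrite {x}defx in Kxq; rewrite inE orbC.
  have := cov q; rewrite !inE -orbA => /or3P[->|/ltps/= lt_pq|]; first by rewrite orbT.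
    by have := topo _ _ Kxq; rewrite ltnNge ltnW.
  case/orP => [/(all_dependents_arc Kxq)|->//]; by rewrite (negPf p_dep).
rewrite /= (successful_safe sG clp); have [disp|meets] := ifPn.
  have [||||c -> le_c] := IHps (p |: G) R X pw uniq_ps.
  - by rewrite setUC; apply: safeU.
  - by [].
  - by move=> q /in_ps; apply: memX.
  - move=> q; have := cov q; rewrite !inE.
    by case: eqP; case: (q \in ps); case: (q \in all_dependents R).
  by exists c.+1.
have pD : p \in D by move: meets; rewrite disjoints1 negbK.
have rootp : p \in root_defects A.
  apply/root_defectsP; split=> // q Kpq; have := topo _ _ Kpq.
  have := clp p q Kpq (set11 p); have [_ disG] := sG.
  by rewrite !inE => /orP[/eqP->|/(disjointFr disG)->//]; rewrite ltnn.
have [|||c -> le_c] := IHps G (p |: R) (X :\: dependents K p) pw uniq_ps sG.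
- by rewrite subUset sub1set rootp.
- by move=> q /in_ps/memX; rewrite all_dependentsU1 !inE negb_or => ->.
- move=> q; have := cov q; rewrite all_dependentsU1 !inE.
  by have [->|_] := eqVneq q p; rewrite ?connect0 ?orbT //=; case: connect; rewrite ?orbT.
by exists c.+1.
Qed.

(** * The main loop and the total cost *)

Definition finish (s : state P) : strategy P {set P} :=
  let: State G R r X := s in
  if 0 < r then test_individually K (in_order L X) G R X else Return P R.

(** When [r = 0] the cardinality bound forces [R] to be complete; the resulting zero cost feeds
    [gbs_bound_failure] at [d = 1]. *)
Lemma run_finish G R r X :
  safe G -> R \subset root_defects A -> #|root_defects A :\: R| <= r ->
  X = ~: (all_dependents R :|: G) ->
  exists c,
    [/\ run (successful A) (finish (State G R r X)) = Some (root_defects A, c),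
        r = 0 -> c = 0 & c <= #|X|].
Proof.
move=> sG rootR le_r defX; case: r le_r => [|r] le_r /=.
  exists 0; split=> //; congr (Some (_, _)); apply/eqP; rewrite eqEsubset rootR.
  by rewrite -setD_eq0 -cards_eq0 -leqn0.
have [||c Erun le_c] :=
  run_test_individually (pairwise_in_order hL X) (uniq_in_order hL X) sG rootR (X := X).
- move=> p; rewrite (mem_in_order hL) defX !inE => /norP[/negPf-> pG].
  by rewrite (negPf pG).
- move=> p; rewrite (mem_in_order hL) defX !inE.
  by case: (p \in all_dependents R); case: (p \in G).
by exists c; split=> //; rewrite -(size_in_order hL X).
Qed.

(** Each iteration removes a package from [X], so fuel [#|X|] suffices. The equation for [X] makes
    it closed modulo [G], since [all_dependents R] contains whatever depends on its members. *)
Lemma run_main_loop m G R r X :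
  #|X| <= m -> safe G -> R \subset root_defects A ->
  #|root_defects A :\: R| <= r -> X = ~: (all_dependents R :|: G) ->
  exists c,
    [/\ run (successful A)
          (bind (while m (@main_cond P) (main_body K L) (State G R r X)) finish) =
          Some (root_defects A, c),
        r = 0 -> c = 0 & gbs_bound r #|X| c].
Proof.
elim: m G R r X => [|m IHm] G R r X le_Xm sG rootR le_r defX.
  have [c [Erun c0 le_c]] := run_finish sG rootR le_r defX.
  exists c; split=> //; last by apply: gbs_bound_linear => //; lia.
  by rewrite -Erun /while; case: ifP => // /andP[_ /= lt_X]; exfalso; lia.
have [cond|ncond] := boolP (main_cond (State G R r X)); last first.
  have [c [Erun c0 le_c]] := run_finish sG rootR le_r defX.
  exists c; split=> //; first by rewrite [while _ _ _ _]/= (negPf ncond).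
  move=> r_gt0; apply: gbs_bound_linear => //.
  by move: ncond; rewrite /main_cond /= r_gt0 -leqNgt.
have /andP[/= r_gt0 lt_X] := cond.
set b := gbs_exponent r #|X|; set T := smallest L (2 ^ b) X.
have cardT : #|T| = 2 ^ b.
  by rewrite (card_smallest hL) // exp2_gbs_exponent_leq.
have subT : T \subset X by apply: smallest_subset hL _ _.
have clX : closed_modulo G X.
  move=> q p Kqp; rewrite defX !inE negb_or => /andP[q_dep _].
  by rewrite (contraNF (all_dependents_arc Kqp) q_dep); case: (p \in G).
have clT : closed_modulo G T by apply: closed_modulo_smallest.
(* One iteration is unfolded and [bind] reassociated, exposing the recursive call to the induction
   hypothesis. *)
have stepE : run (successful A)
    (bind (while m.+1 (@main_cond P) (main_body K L) (State G R r X)) finish) =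
  if run (successful A)
     (if [disjoint T & D]
      then bind (while m (@main_cond P) (main_body K L)
                   (State (G :|: T) R r (X :\: (G :|: T)))) finish
      else bind (find_single_defect L G T) (fun '(G', p) =>
        bind (while m (@main_cond P) (main_body K L)
                (State G' (p |: R) (r - 1) ((X :\: dependents K p) :\: G'))) finish))
    is Some (x, c) then Some (x, c.+1) else None.
  rewrite [while _ _ _ _]/= cond [LHS]/= -/(gbs_exponent r #|X|) -/b -/T.
  rewrite (successful_safe sG clT); case: ifP => // _.
  rewrite run_bindA run_bindA !(run_bind _ (find_single_defect L G T)).
  by case: (run _ (find_single_defect L G T)) => [[[G' p] c]|].
rewrite {}stepE; have [disT|meetsT] := ifPn.
  have defX' : X :\: (G :|: T) = X :\: T.
    rewrite -setDDl; congr (_ :\: _); apply/setP => p.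
    by rewrite defX !inE negb_or andbCA andbb.
  have cardX' : #|X :\: T| = #|X| - 2 ^ b by rewrite cardsD (setIidPr subT) cardT.
  have [|||c [-> c0 bnd]] := IHm (G :|: T) R r (X :\: (G :|: T)) _ _ rootR le_r.
  - have := expn_gt0 2 b; rewrite defX' cardX'; lia.
  - exact: safeU.
  - by rewrite defX' {1}defX setUA [RHS]setCU setDE.
  exists c.+1; split=> //; first by move=> r0; rewrite r0 in r_gt0.
  by apply: gbs_bound_success => //; rewrite -cardX' -defX'.
rewrite (run_bind _ (find_single_defect L G T)).
have [G' [p [-> sG' subG pT rootp]]] := run_find_single_defect cardT sG clT meetsT.
have pX := subsetP subT p pT.
set X' := _ :\: G'.
have ltX' : #|X'| < #|X|.
  apply: proper_card; apply/properP; split.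
    by rewrite /X' setDDl subsetDl.
  by exists p; rewrite ?pX // !inE connect0 andbF.
have pR : p \notin R.
  apply: contraL pX => pR; rewrite defX inE negbK inE.
  by rewrite (subsetP (subset_all_dependents R)).
have [||||c [-> c0 bnd]] := IHm G' (p |: R) (r - 1) X' _ sG'.
- by lia.
- by rewrite subUset sub1set rootp.
- have := cardsD1 p (root_defects A :\: R).
  by rewrite in_setD pR rootp setDDl [R :|: _]setUC; lia.
- apply/setP => q; rewrite all_dependentsU1 /X' defX !inE !negb_or.
  have := subsetP subG q; case: (q \in G) => [/(_ isT)->|_].
    by rewrite !andbF.
  by rewrite /= andbT andbC.
exists (b + c).+1; split=> //; first by move=> r0; rewrite r0 in r_gt0.
by apply: gbs_bound_failure ltX' bnd _ => // r1; apply: c0; rewrite r1.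
Qed.

Lemma full_learning_root_defects :
  full_learning A = learned_graph K (root_defects A).
Proof.
rewrite /full_learning /learned_graph dependenciesE hC.
by rewrite -/(all_dependents _) all_dependents_root_defects.
Qed.

End Correctness.

Theorem theorem2 (P : finType) (n : nat) (hn : #|P| = n)
  (A : repository P) (hA : valid_repository A)
  (hU : unknown A = set0) (hC : conflicts A = set0)
  (r : nat) (hr : #|root_defects A| <= r)
  (L : seq P) (hL : topological_order (known A) L) :
  exists (R : {set P}) (queries : nat),
    [/\ run (successful A) (find_defects (known A) L r) = Some (R, queries),
        R = root_defects A,
        full_learning A = learned_graph (known A) R &
        queries <= up_log 2 (\sum_(0 <= i < r.+1) 'C(n, i)) + r - 1].
Proof.
have [|||||c [Erun c0 bnd]] :=
  @run_main_loop P A L hA hU hC hL #|P| set0 set0 r [set: P].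
- by rewrite cardsT.
- by split=> [q p _|]; rewrite ?inE // disjoints_subset sub0set.
- exact: sub0set.
- by rewrite setD0.
- by rewrite /all_dependents big_set0 setU0 setC0.
exists (root_defects A), c; split=> //; first exact: full_learning_root_defects hA hU hC hL.
(* At [r = 0] [gbs_bound] is vacuous and the count comes from [c0]. *)
have [r0|r_gt0] := posnP r; first by rewrite c0.
by apply: gbs_bound_up_log => //; rewrite -hn -cardsT.
Qed.
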